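(* Let $\mathcal{X}=(X,d_X,f_X)$ be a finite augmented metric space with $f_X$ injective such that $M:=\mathrm{H}_0(\mathcal{R}^{\mathrm{bi}}_\bullet(\mathcal{X})):\mathbb{R}^2\to\mathbf{Vec}$ is interval decomposable. Then the barcode of $M$ coincides with the elder-rule-staircode $\{\!\{I_x:x\in X\}\!\}$ of $\mathcal{X}$.
   Context: **Augmented metric spaces and Rips bifiltration.** A finite augmented metric space is a triple $\mathcal{X}=(X,d_X,f_X)$ with $(X,d_X)$ a finite metric space and $f_X:X\to\mathbb{R}$. Put $X_\sigma=\{x\in X: f_X(x)\le\sigma\}$. $\mathcal{R}_\varepsilon(X_\sigma,d_X)$ is the simplicial complex whose simplices are the nonempty $A\subseteq X_\sigma$ with $d_X(a,a')\le\varepsilon$ for all $a,a'\in A$ (empty if $\varepsilon<0$). The Rips bifiltration $\mathcal{R}^{\mathrm{bi}}_\bullet(\mathcal{X})$ is the functor on $\mathbb{R}^2$ (product order) sending $(\sigma,\varepsilon)$ to $\mathcal{R}_\varepsilon(X_\sigma,d_X)$, with inclusions as internal maps. $\mathrm{H}_0$ is simplicial homology with coefficients in a fixed field $\mathbb{F}$; $\mathbf{Vec}$ is the category of finite-dimensional $\mathbb{F}$-vector spaces. **Elder-rule-staircode (injective case).** For $\varepsilon\ge 0$ and $x\in X_\sigma$, $[x]_{(\sigma,\varepsilon)}$ is the set of all $x'\in X_\sigma$ joined to $x$ by a sequence in $X_\sigma$ with consecutive distances $\le\varepsilon$. The point $x$ is older than $x'$ if $f_X(x)<f_X(x')$. $I_x:=\{(\sigma,\varepsilon)\in\mathbb{R}^2:\varepsilon\ge0,\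 x\in X_\sigma,\ x\text{ is the oldest element of }[x]_{(\sigma,\varepsilon)}\}$. **Interval decomposability.** For a poset $\mathbb{P}$, an interval $\mathcal{J}\subseteq\mathbb{P}$ is a nonempty, convex ($a,b\in\mathcal{J}$, $a\le c\le b$ imply $c\in\mathcal{J}$) subset in which any two elements are joined by a finite sequence of elements of $\mathcal{J}$ with consecutive elements comparable. The interval module $I^{\mathcal{J}}$ is $\mathbb{F}$ on $\mathcal{J}$ with identity internal maps within $\mathcal{J}$, and $0$ elsewhere. A functor $N:\mathbb{P}\to\mathbf{Vec}$ is interval decomposable if $N\cong\bigoplus_{\mathcal{J}\in B}I^{\mathcal{J}}$ for some multiset $B$ of intervals; $B$ is then unique and is called the barcode of $N$. *)

(* Defs.v *)
From HB Require Import structures.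
From mathcomp Require Import all_boot all_order all_algebra.
From mathcomp Require Import all_classical all_reals.
From mathcomp Require Import topology_structure uniform_structure.
From mathcomp Require Import pseudometric_structure metric_structure.

Set Implicit Arguments.
Unset Strict Implicit.
Unset Printing Implicit Defensive.

Import Order.TTheory Order.ProdSyntax GRing.Theory Num.Theory.

Local Open Scope quotient_scope.
Local Open Scope ring_scope.

(* The values are F-vector spaces without a dimension bound, so that arbitrary
   direct sums exist; pointwise finite-dimensional modules form a full
   subcategory, singled out by [pfd]. *)
Record pmod (F : fieldType) (d : Order.disp_t) (P : porderType d) := Pmod {
  pm_obj :> P -> lmodType F;
  pm_map : forall a b : P, (a <= b)%O -> {linear pm_obj a -> pm_obj b};
  pm_map_id : forall (a : P) (h : (a <= a)%O) v, pm_map h v = v;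
  pm_map_comp : forall (a b c : P) (hab : (a <= b)%O) (hbc : (b <= c)%O)
    (hac : (a <= c)%O) v, pm_map hac v = pm_map hbc (pm_map hab v) }.

Definition pfd (F : fieldType) d (P : porderType d) (N : pmod F P) : Prop :=
  forall a : P, exists (V : vectType F) (f : {linear V -> N a}), bijective f.

Definition pm_iso (F : fieldType) d (P : porderType d) (M N : pmod F P) : Prop :=
  exists phi : forall a : P, {linear M a -> N a},
    (forall a, bijective (phi a)) /\
    (forall (a b : P) (h : (a <= b)%O) v,
       phi b (pm_map M h v) = pm_map N h (phi a v)).

Definition dprod (F : fieldType) (I : Type) (V : I -> lmodType F) : Type :=
  forall i, V i.

Section DirectProduct.
Variables (F : fieldType) (I : Type) (V : I -> lmodType F).

HB.instance Definition _ := Choice.copy (dprod V) (forall i, V i).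

Let zero : dprod V := fun=> 0.
Let opp (f : dprod V) : dprod V := fun i => - f i.
Let add (f g : dprod V) : dprod V := fun i => f i + g i.
Let scale (k : F) (f : dprod V) : dprod V := fun i => k *: f i.

Let addA : associative add.
Proof. by move=> f g h; apply: functional_extensionality_dep => i; exact: addrA. Qed.
Let addC : commutative add.
Proof. by move=> f g; apply: functional_extensionality_dep => i; exact: addrC. Qed.
Let add0 : left_id zero add.
Proof. by move=> f; apply: functional_extensionality_dep => i; exact: add0r. Qed.
Let addN : left_inverse zero opp add.
Proof. by move=> f; apply: functional_extensionality_dep => i; exact: addNr. Qed.
HB.instance Definition _ := GRing.isZmodule.Build (dprod V) addA addC add0 addN.

Let scaleA k l f : scale k (scale l f) = scale (k * l) f.
Proof. by apply: functional_extensionality_dep => i; exact: scalerA. Qed.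
Let scale1 : left_id 1 scale.
Proof. by move=> f; apply: functional_extensionality_dep => i; exact: scale1r. Qed.
Let scaleDr : right_distributive scale +%R.
Proof. by move=> k f g; apply: functional_extensionality_dep => i; exact: scalerDr. Qed.
Let scaleDl f : {morph scale^~ f : k l / k + l}.
Proof. by move=> k l; apply: functional_extensionality_dep => i; exact: scalerDl. Qed.
HB.instance Definition _ :=
  GRing.Zmodule_isLmodule.Build F (dprod V) scaleA scale1 scaleDr scaleDl.

Definition dsupp (f : dprod V) : set I := [set i | f i <> 0]%classic.

Definition fin_supp : {pred dprod V} := fun f => `[< finite_set (dsupp f) >].

Fact fin_supp_submod : submod_closed fin_supp.
Proof.
split=> [|k f g /asboolP Hf /asboolP Hg]; apply/asboolP.
  by apply: (@sub_finite_set _ _ set0) => // i; apply.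
apply: (@sub_finite_set _ _ (dsupp f `|` dsupp g)%classic).
  move=> i H; apply: contrapT => /not_orP[/contrapT Hfi /contrapT Hgi].
  apply: H; change (k *: f i + g i = 0).
  by rewrite Hfi Hgi scaler0 addr0.
by rewrite finite_setU.
Qed.
HB.instance Definition _ :=
  GRing.isSubmodClosed.Build F (dprod V) fin_supp fin_supp_submod.

Record dsum : Type := Dsum { dsum_val :> dprod V; _ : dsum_val \in fin_supp }.

HB.instance Definition _ := [isSub for dsum_val].
HB.instance Definition _ := [Choice of dsum by <:].
HB.instance Definition _ := [SubChoice_isSubLmodule of dsum by <:].

End DirectProduct.

Section DirectSumMap.
Variables (F : fieldType) (I : Type) (V W : I -> lmodType F).
Variable g : forall i, {linear V i -> W i}.

Fact dsum_map_subproof (f : dsum V) :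
  ((fun i => g i (dsum_val f i)) : dprod W) \in @fin_supp F I W.
Proof.
case: f => f /= /asboolP Hf; apply/asboolP.
apply: sub_finite_set Hf => i H fi0; apply: H.
by rewrite fi0 linear0.
Qed.

Definition dsum_map (f : dsum V) : dsum W := Dsum (dsum_map_subproof f).

Fact dsum_map_linear : linear dsum_map.
Proof.
move=> k u v; apply: val_inj; apply: functional_extensionality_dep => i.
exact: linearP.
Qed.
HB.instance Definition _ := GRing.isSemilinear.Build F (dsum V) (dsum W) _
  dsum_map (GRing.semilinear_linear dsum_map_linear).

End DirectSumMap.

Section PmodSum.
Variables (F : fieldType) (d : Order.disp_t) (P : porderType d).
Variables (I : Type) (N : I -> pmod F P).

Program Definition pm_dsum : pmod F P := {|
  pm_obj := fun a => dsum (fun i => N i a);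
  pm_map := fun a b h => dsum_map (fun i => pm_map (N i) h) |}.
Next Obligation.
move=> a h v; apply: val_inj; apply: functional_extensionality_dep => i.
exact: pm_map_id.
Qed.
Next Obligation.
move=> a b c hab hbc hac v; apply: val_inj.
apply: functional_extensionality_dep => i; exact: pm_map_comp.
Qed.

End PmodSum.

Section Intervals.
Variables (d : Order.disp_t) (P : porderType d).

Definition convex_subset (J : set P) : Prop :=
  forall a b c : P, J a -> J b -> (a <= c)%O -> (c <= b)%O -> J c.

Definition connected_subset (J : set P) : Prop :=
  forall a b : P, J a -> J b ->
    exists s : seq P, [/\ path (>=<%O) a s, last a s = b &
                          forall c, c \in s -> J c].

Definition is_interval (J : set P) : Prop :=
  [/\ (J !=set0)%classic, convex_subset J & connected_subset J].

(* A multiset of subsets of P is a family, taken up to reindexing. *)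
Record multiset : Type := Multiset { ms_idx : Type; ms_set :> ms_idx -> set P }.

Definition multiset_eq (A B : multiset) : Prop :=
  exists2 phi : ms_idx A -> ms_idx B,
    bijective phi & forall i, A i = B (phi i).

End Intervals.

Section IntervalModule.
Variables (F : fieldType) (d : Order.disp_t) (P : porderType d).

(* The line F on J, the zero space elsewhere, both as subspaces of F^o. *)
Definition itv_space (J : set P) (a : P) : {vspace F^o} :=
  if `[< J a >] then fullv else 0%VS.

(* [vsproj] is the identity between two copies of F, and is 0 as soon as its
   source or its target is the zero space. *)
Definition itv_map (J : set P) (a b : P) :
    subvs_of (itv_space J a) -> subvs_of (itv_space J b) :=
  vsproj (itv_space J b) \o vsval.
HB.instance Definition _ J a b := GRing.Linear.copy (@itv_map J a b)
  ((@vsproj F F^o (itv_space J b)) \o (@vsval F F^o (itv_space J a))).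

Variables (J : set P) (hJ : is_interval J).

Program Definition interval_module : pmod F P := {|
  pm_obj := fun a => subvs_of (itv_space J a);
  pm_map := fun a b _ => @itv_map J a b |}.
Next Obligation. by move=> a h v; exact: vsvalK. Qed.
Next Obligation.
move=> a b c hab hbc hac v.
have z (x : P) (w : subvs_of (itv_space J x)) : ~ J x -> vsval w = 0.
  move=> nJ; have := subvsP w.
  by move: (vsval w) => w'; rewrite /itv_space asboolF // memv0 => /eqP.
suff E : vsproj (itv_space J c) (vsval v) =
    vsproj (itv_space J c) (vsval (vsproj (itv_space J b) (vsval v))) by exact: E.
case: (pselect (J b)) => [Jb|nJb].
  congr (vsproj _ _); rewrite vsprojK //; move: (vsval v) => w.
  by rewrite /itv_space asboolT ?memvf.
rewrite [vsval (vsproj _ _)]z // linear0.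
case: (pselect (J a)) => [Ja|nJa]; last by rewrite (z a v) // linear0.
case: (pselect (J c)) => [Jc|nJc]; last by apply: val_inj; rewrite [LHS]z.
by have [_ cJ _] := hJ; case: nJb; apply: cJ hab hbc.
Qed.

End IntervalModule.

Definition is_barcode (F : fieldType) d (P : porderType d)
    (N : pmod F P) (B : multiset P) : Prop :=
  exists hB : forall i, is_interval (B i),
    pm_iso N (pm_dsum (fun i => interval_module F (hB i))).

Definition interval_decomposable (F : fieldType) d (P : porderType d)
    (N : pmod F P) : Prop :=
  exists B : multiset P, is_barcode N B.

Section QuotientSpace.
Variables (F : fieldType) (V : vectType F) (U : {vspace V}).

Definition quotv : Type := Quotient.quot (R := V) U.
HB.instance Definition _ := GRing.Zmodule.on quotv.
HB.instance Definition _ := EqQuotient.on quotv.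

Definition pi_quotv (v : V) : quotv := \pi_(Quotient.quot (R := V) U) v.

Lemma pi_quotv_eq v w : (pi_quotv v = pi_quotv w) <-> (v - w \in U).
Proof.
rewrite /pi_quotv Quotient.idealrBE.
by split=> [->|/eqP].
Qed.

Lemma pi_quotv_repr (q : quotv) : pi_quotv (repr q) = q.
Proof. exact: reprK. Qed.

Let scale (k : F) (q : quotv) : quotv := pi_quotv (k *: repr q).

Let pi_add v w : pi_quotv (v + w) = pi_quotv v + pi_quotv w.
Proof. exact: (@Quotient.pi_add V U). Qed.

Let pi_scale k v : pi_quotv (k *: v) = scale k (pi_quotv v).
Proof.
apply/pi_quotv_eq; rewrite -scalerBr memvZ //.
by apply/pi_quotv_eq; rewrite pi_quotv_repr.
Qed.

Let scaleA k l q : scale k (scale l q) = scale (k * l) q.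
Proof. by rewrite -(pi_quotv_repr q) -!pi_scale scalerA. Qed.
Let scale1 : left_id 1 scale.
Proof. by move=> q; rewrite -(pi_quotv_repr q) -!pi_scale scale1r. Qed.
Let scaleDr : right_distributive scale +%R.
Proof.
move=> k p q; rewrite -(pi_quotv_repr p) -(pi_quotv_repr q).
by rewrite -pi_add -!pi_scale -pi_add scalerDr.
Qed.
Let scaleDl q : {morph scale^~ q : k l / k + l}.
Proof.
by move=> k l; rewrite -(pi_quotv_repr q) -!pi_scale -pi_add scalerDl.
Qed.
HB.instance Definition _ :=
  GRing.Zmodule_isLmodule.Build F quotv scaleA scale1 scaleDr scaleDl.

Fact pi_quotv_linear : linear pi_quotv.
Proof. by move=> k u v; rewrite pi_add pi_scale. Qed.
HB.instance Definition _ := GRing.isSemilinear.Build F V quotv _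
  pi_quotv (GRing.semilinear_linear pi_quotv_linear).

Lemma quotv_findim :
  exists (W : vectType F) (f : {linear W -> quotv}), bijective f.
Proof.
exists (subvs_of (U^C)%VS : vectType F).
exists (pi_quotv \o @vsval F V (U^C)%VS).
exists (fun q => vsproj (U^C)%VS (repr q - projv U (repr q))) => [w|q].
  apply: val_inj => /=; set r := repr _.
  rewrite [LHS]vsprojK ?memv_projC //.
  have /projv_id : vsval w - r \in U by apply/pi_quotv_eq; rewrite pi_quotv_repr.
  have -> : projv U (vsval w - r) = - projv U r.
    rewrite linearB /=; suff -> : projv U (vsval w) = 0 by rewrite sub0r.
    by apply/eqP; rewrite -memv_ker lker_proj subvsP.
  by move=> ->; rewrite addrC subrK.
rewrite -[RHS]pi_quotv_repr; apply/pi_quotv_eq.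
rewrite /= [vsval _]vsprojK ?memv_projC //.
by rewrite addrAC subrr sub0r memvN memv_proj.
Qed.

End QuotientSpace.

Section Homology.
Variables (F : fieldType) (X : finType).

Record complex : Type := Complex {
  simplices :> {set {set X}};
  simplex_neq0 : finset.set0 \notin simplices;
  simplex_face : forall A B : {set X},
    A \in simplices -> B != finset.set0 -> B \subset A -> B \in simplices }.

(* The chains of all complexes on the vertex set X live in one ambient space. *)
Definition ambient : vectType F := {ffun {set X} -> F^o}.

Definition simplex (A : {set X}) : ambient := [ffun B => (B == A)%:R].

(* Simplices are oriented by the enumeration order of X.  Vertices have zero
   boundary: the homology is not reduced. *)
Definition bd_fun (c : ambient) : ambient :=
  \sum_(A : {set X} | (1 < #|A|)%N) \sum_(a in A)
    ((-1) ^+ index a (enum A) * c A) *: simplex (A :\ a).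

Fact bd_fun_linear : linear bd_fun.
Proof.
move=> k u v; rewrite /bd_fun scaler_sumr -big_split; apply: eq_bigr => A _.
rewrite scaler_sumr -big_split; apply: eq_bigr => a _.
by rewrite !ffunE /= scalerA -scalerDl mulrDr mulrCA.
Qed.
HB.instance Definition _ := GRing.isSemilinear.Build F ambient ambient _
  bd_fun (GRing.semilinear_linear bd_fun_linear).

Definition bd : 'End(ambient) := linfun bd_fun.

Definition chains (n : nat) (K : complex) : {vspace ambient} :=
  (\sum_(A in simplices K | #|A| == n.+1) <[simplex A]>)%VS.

Definition cycles (n : nat) (K : complex) : {vspace ambient} :=
  (chains n K :&: lker bd)%VS.

Definition boundaries (n : nat) (K : complex) : {vspace ambient} :=
  (bd @: chains n.+1 K)%VS.

Definition boundaries_in (n : nat) (K : complex) :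
    {vspace subvs_of (cycles n K)} :=
  (linfun (@vsval F ambient (cycles n K)) @^-1: boundaries n K)%VS.

Definition homology (n : nat) (K : complex) : lmodType F :=
  quotv (boundaries_in n K).

(* Meaningful for c in [cycles n K], see [hclass_eq]. *)
Definition hclass (n : nat) (K : complex) (c : ambient) : homology n K :=
  pi_quotv (boundaries_in n K) (vsproj (cycles n K) c).

(* Induced by the inclusion K \subset L, see [homology_mapE]. *)
Definition homology_map (n : nat) (K L : complex) (h : homology n K) :
    homology n L :=
  hclass n L (vsval (repr h)).

Lemma chainsS n (K L : complex) : K \subset L -> (chains n K <= chains n L)%VS.
Proof.
move=> KL; apply/subv_sumP => A /andP[AK An].
by apply: (sumv_sup A) => //; rewrite (fintype.subsetP KL) // An.
Qed.

Lemma cyclesS n (K L : complex) : K \subset L -> (cycles n K <= cycles n L)%VS.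
Proof. by move=> KL; rewrite capvS ?chainsS. Qed.

Lemma boundariesS n (K L : complex) :
  K \subset L -> (boundaries n K <= boundaries n L)%VS.
Proof. by move=> KL; rewrite limgS ?chainsS. Qed.

Lemma hclass_repr n (K : complex) (h : homology n K) :
  hclass n K (vsval (repr h)) = h.
Proof. by rewrite /hclass vsvalK pi_quotv_repr. Qed.

Lemma hclass_eq n (K : complex) (c c' : ambient) :
  c \in cycles n K -> c' \in cycles n K ->
  (hclass n K c = hclass n K c') <-> (c - c' \in boundaries n K).
Proof.
move=> Kc Kc'; rewrite /hclass pi_quotv_eq -memv_preim lfunE /=.
by rewrite !vsprojK.
Qed.

Lemma homology_mapE n (K L : complex) (c : ambient) :
  K \subset L -> c \in cycles n K ->
  homology_map L (hclass n K c) = hclass n L c.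
Proof.
move=> KL Kc; rewrite /homology_map.
apply/hclass_eq; try by rewrite (subvP (cyclesS n KL)) // subvsP.
apply: (subvP (boundariesS n KL)); apply/hclass_eq => //.
  exact: subvsP.
by rewrite hclass_repr.
Qed.

Fact homology_map_linear n (K L : complex) (KL : K \subset L) :
  linear (@homology_map n K L).
Proof.
move=> k p q; rewrite -(hclass_repr p) -(hclass_repr q).
set u := vsval (repr p); set v := vsval (repr q).
have Ku : u \in cycles n K by apply: subvsP.
have Kv : v \in cycles n K by apply: subvsP.
have hlin (K' : complex) : hclass n K' (k *: u + v)
  = k *: hclass n K' u + hclass n K' v by rewrite /hclass !linearP.
have Kuv : k *: u + v \in cycles n K by rewrite memvD ?memvZ.
by rewrite -hlin !homology_mapE // hlin.
Qed.

Definition homology_lmap n (K L : complex) (KL : K \subset L) :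
    {linear homology n K -> homology n L} :=
  HB.pack (@homology_map n K L)
    (GRing.isSemilinear.Build F (homology n K) (homology n L) _
       (@homology_map n K L)
       (GRing.semilinear_linear (homology_map_linear KL))).

End Homology.

Section FilteredHomology.
Variables (F : fieldType) (X : finType) (d : Order.disp_t) (P : porderType d).
Variables (K : P -> complex X).
Hypothesis K_mono : forall a b : P, (a <= b)%O -> K a \subset K b.

Program Definition filtered_homology (n : nat) : pmod F P := {|
  pm_obj := fun a => homology F n (K a);
  pm_map := fun a b h => homology_lmap F n (K_mono h) |}.
Next Obligation. by move=> n a h v; exact: hclass_repr. Qed.
Next Obligation.
move=> n a b c hab hbc hac v; rewrite /= -(hclass_repr v).
rewrite !homology_mapE ?subvsP ?K_mono //.
exact: (subvP (cyclesS _ _ (K_mono hab))) (subvsP _).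
Qed.

Lemma filtered_homology_pfd n : pfd (filtered_homology n).
Proof.
move=> a.
exact: quotv_findim.
Qed.

End FilteredHomology.

#[short(type="finMetricType")]
HB.structure Definition FinMetric (R : realType) :=
  { T of Finite T & Metric R T }.

Section AugmentedMetricSpace.
Variables (R : realType) (X : finMetricType R) (f : X -> R).

Definition sublevel (s : R) : {set X} := [set x | f x <= s]%SET.

Definition rips_simplices (s e : R) : {set {set X}} :=
  [set A : {set X} | [&& A != finset.set0, A \subset sublevel s &
     [forall a in A, forall b in A, mdist a b <= e]]]%SET.

Program Definition rips (s e : R) : complex X :=
  {| simplices := rips_simplices s e |}.
Next Obligation. by move=> s e; rewrite inE eqxx. Qed.
Next Obligation.
move=> s e A B; rewrite !inE => /and3P[_ As Ae] B0 BA.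
rewrite B0 (fintype.subset_trans BA As) /=.
apply/forall_inP => a Ba; apply/forall_inP => b Bb.
by have /forall_inP/(_ a (fintype.subsetP BA _ Ba))/forall_inP/(_ b (fintype.subsetP BA _ Bb)) := Ae.
Qed.

(* [R *p R] is R^2 with the product order. *)
Definition rips_bifiltration (p : R *p R) : complex X := rips p.1 p.2.

Lemma rips_bifiltration_mono (p q : R *p R) :
  (p <= q)%O -> rips_bifiltration p \subset rips_bifiltration q.
Proof.
rewrite leEprod => /andP[p1 p2]; apply/fintype.subsetP => A.
rewrite !inE => /and3P[-> As Ae] /=; apply/andP; split.
  by apply/fintype.subsetP => x /(fintype.subsetP As); rewrite !inE => /le_trans; apply.
apply/forall_inP => a Aa; apply/forall_inP => b Ab.
by have /forall_inP/(_ a Aa)/forall_inP/(_ b Ab)/le_trans := Ae; apply.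
Qed.

Definition rips_H0 (F : fieldType) : pmod F (R *p R) :=
  filtered_homology F rips_bifiltration_mono 0.

Definition rips_step (s e : R) : rel X :=
  [rel x y | [&& x \in sublevel s, y \in sublevel s & mdist x y <= e]].

Definition block (s e : R) (x : X) : {set X} :=
  [set y in sublevel s | connect (rips_step s e) x y]%SET.

Definition older (x y : X) : bool := f x < f y.

Definition staircase (x : X) : set (R *p R) :=
  [set p | [/\ 0 <= p.2, x \in sublevel p.1 &
     forall y, y \in block p.1 p.2 x -> y != x -> older x y]]%classic.

Definition staircode : multiset (R *p R) := Multiset staircase.

End AugmentedMetricSpace.

(* Main.v *)
Require Import Defs.
From HB Require Import structures.
From mathcomp Require Import all_boot all_order all_algebra.
From mathcomp Require Import all_classical all_reals.
From mathcomp Require Import metric_structure.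

(* The points (f x, 0) form a chain in R^2, and M is generated by its values on
   this chain, with at most one new generator at each of its points.  Hence in
   any decomposition of M every interval has a least element (f x, 0), and each
   x is the origin of exactly one interval J_x.  Because the intervals start at
   the points of a chain, p lies in J_x if and only if some element of
   M(f x, 0) survives at p without coming from an older point; this condition
   does not mention the decomposition.  For M = H_0 of the Rips bifiltration it
   says that x is the oldest element of its component at p, i.e. p lies in I_x. *)

Set Implicit Arguments.
Unset Strict Implicit.
Unset Printing Implicit Defensive.

Import Order.TTheory GRing.Theory Num.Theory.

Local Open Scope ring_scope.

(** * Extrema along a finite chain *)

Section ChainExtrema.
Variables (d : Order.disp_t) (P : porderType d) (X : finType) (t : X -> P).
Hypothesis t_chain : forall x y, (t x >=< t y)%O.

Lemma chain_max (Q : pred X) x0 : Q x0 ->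
  exists2 y, Q y & forall z, Q z -> (t z <= t y)%O.
Proof.
move=> Qx0.
have [] := @extremum_inP P X >=%O x0 Q t _ _ _ Qx0.
- by move=> x _ /=.
- by move=> y x z _ _ _ /= yx zy; apply: le_trans zy yx.
- by move=> x y _ _ /=; rewrite orbC; exact: t_chain.
by move=> y Qy ymax; exists y.
Qed.

Lemma chain_min (Q : pred X) x0 : Q x0 ->
  exists2 y, Q y & forall z, Q z -> (t y <= t z)%O.
Proof.
move=> Qx0.
have [] := @extremum_inP P X <=%O x0 Q t _ _ _ Qx0.
- by move=> x _ /=.
- by move=> y x z _ _ _ /=; apply: le_trans.
- by move=> x y _ _ /=; exact: t_chain.
by move=> y Qy ymin; exists y.
Qed.

End ChainExtrema.

(** * Interval modules and direct sums *)

Section IntervalModuleTheory.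
Variables (F : fieldType) (d : Order.disp_t) (P : porderType d).

Lemma itv_space_out (J : set P) (a : P) (v : subvs_of (itv_space F J a)) :
  ~ J a -> v = 0.
Proof.
move=> nJ; apply: val_inj; have := subvsP v.
by rewrite /= {2}/itv_space asboolF // memv0 => /eqP.
Qed.

(** [itv_map] asks for no order between its endpoints, so it can also go backwards; the space at [b]
    is all of F and loses nothing, whether or not [a] lies in [J]. *)
Lemma itv_mapK (J : set P) (a b : P) : J b ->
  cancel (@itv_map F d P J a b) (@itv_map F d P J b a).
Proof.
move=> Jb v; rewrite /itv_map /= [vsval (vsproj _ _)]vsprojK ?vsvalK //.
by move: (vsval v) => w; rewrite /itv_space asboolT // memvf.
Qed.

End IntervalModuleTheory.

Section DirectSumTheory.
Variables (F : fieldType) (I : Type) (V : I -> lmodType F).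

Lemma dsum_eq (u v : dsum V) : (forall i, dsum_val u i = dsum_val v i) -> u = v.
Proof. by move=> uv; apply: val_inj; apply: functional_extensionality_dep. Qed.

Fact dsum_single_subproof (i : I) (f : forall j, V j) :
  ((fun j => if `[< j = i >] then f j else 0) : dprod V) \in @fin_supp F I V.
Proof.
apply/asboolP; apply: (@sub_finite_set _ _ [set i]%classic) => // j.
by rewrite /dsupp /=; case: ifP => // /asboolP.
Qed.

(* A whole family [f] is given, rather than a vector of [V i], so that no
   transport along [j = i] is needed. *)
Definition dsum_single (i : I) (f : forall j, V j) : dsum V :=
  Dsum (dsum_single_subproof i f).

Lemma dsum_single_id i f : dsum_val (dsum_single i f) i = f i.
Proof. by rewrite /= asboolT. Qed.

Lemma dsum_single_neq i j f : j <> i -> dsum_val (dsum_single i f) j = 0.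
Proof. by move=> ji; rewrite /= asboolF. Qed.

End DirectSumTheory.

(** * Liveness as an isomorphism invariant *)

Section Live.
Variables (F : fieldType) (d : Order.disp_t) (P : porderType d).
Variables (X : finType) (t : X -> P).

(* [live N x] is a purely algebraic substitute for the interval born at [t x]:
   [p] is in it when some element of [N (t x)] is not identified at [p] with
   one coming from an earlier point of the chain.  It depends on [N] only up to
   isomorphism, and it can be computed on any decomposition of [N]. *)
Definition aged (N : pmod F P) (x : X) (p : P) (v : N p) : Prop :=
  v = 0 \/
  exists y (h : (t y <= p)%O) (w : N (t y)), (t y < t x)%O /\ v = pm_map N h w.

Definition live (N : pmod F P) (x : X) : set P :=
  [set p | exists (h : (t x <= p)%O) (v : N (t x)),
     ~ aged x (pm_map N h v)]%classic.

(** A single image suffices, rather than a sum of images: along a chain the latest birth point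
    involved dominates the others. *)
Definition generated_by (N : pmod F P) : Prop :=
  forall p (v : N p), v <> 0 ->
    exists y (h : (t y <= p)%O) (w : N (t y)), v = pm_map N h w.

(** When the points [t y] form a chain, the aged elements of [N (t x)] form a subspace; its
    codimension is bounded by one here without forming a quotient. *)
Definition one_birth (N : pmod F P) : Prop :=
  forall x (u v : N (t x)), exists k l : F,
    (k != 0) || (l != 0) /\ aged x (k *: u + l *: v).


Lemma pm_iso_sym (M N : pmod F P) : pm_iso M N -> pm_iso N M.
Proof.
move=> [phi [bij nat]].
have inv a : {g : {linear N a -> M a} | cancel (phi a) g & cancel g (phi a)}.
  have /cid[g [phiK gK]] : exists g, cancel (phi a) g /\ cancel g (phi a).
    by have [g ? ?] := bij a; exists g.
  pose gL := GRing.isSemilinear.Build F (N a) (M a) _ g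
    (GRing.semilinear_linear (can2_linear phiK gK)).
  pose G : {linear N a -> M a} := HB.pack g gL.
  by exists G.
exists (fun a => s2val (inv a)); split.
  by move=> a; case: (inv a) => g K1 K2 /=; exists (phi a).
move=> a b h v; case: (inv b) => gb K1 K2 /=; case: (inv a) => ga K3 K4 /=.
by rewrite -{1}(K4 v) -nat K1.
Qed.

Lemma aged_iso (M N : pmod F P) (phi : forall a, {linear M a -> N a}) x p v :
  (forall (a b : P) (h : (a <= b)%O) v,
     phi b (pm_map M h v) = pm_map N h (phi a v)) ->
  aged x v -> aged x (phi p v).
Proof.
move=> nat [->|[y [h [w [yx ->]]]]]; first by left; rewrite linear0.
by right; exists y, h, (phi _ w); rewrite nat.
Qed.

Lemma generated_iso (M N : pmod F P) :
  pm_iso M N -> generated_by M -> generated_by N.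
Proof.
move=> [phi [bij nat]] gen p v; have [g gK Kg] := bij p.
rewrite -(Kg v) => v0; have [E|y [h [w ->]]] := gen p (g v).
  by rewrite E linear0 in v0.
by exists y, h, (phi _ w); rewrite nat.
Qed.

Lemma one_birth_iso (M N : pmod F P) :
  pm_iso M N -> one_birth M -> one_birth N.
Proof.
move=> [phi [bij nat]] one x u v; have [g gK Kg] := bij (t x).
have [k [l [kl /(aged_iso nat)]]] := one x (g u) (g v).
by rewrite linearD !linearZ /= !Kg; exists k, l.
Qed.

Lemma live_iso (M N : pmod F P) x : pm_iso M N -> live M x = live N x.
Proof.
have sub M' N' : pm_iso M' N' -> (live M' x `<=` live N' x)%classic.
  move=> /pm_iso_sym[phi [bij nat]] p [h [v nold]].
  have [g gK Kg] := bij (t x); exists h, (g v) => /(aged_iso nat).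
  by rewrite nat Kg.
by move=> MN; apply/seteqP; split; apply: sub => //; exact: pm_iso_sym.
Qed.

Hypothesis t_chain : forall x y, (t x >=< t y)%O.
Hypothesis t_inj : injective t.

(** * Birth points in an interval decomposition *)

Section Barcode.
Variables (I : Type) (J : I -> set P) (hJ : forall i, is_interval (J i)).
Let D := pm_dsum (fun i => interval_module F (hJ i)).
Hypothesis D_gen : generated_by D.
Hypothesis D_one : one_birth D.

Definition least (i : I) (x : X) : Prop :=
  J i (t x) /\ forall q, J i q -> (t x <= q)%O.

(** The generator of summand [i]; outside [J i] it is 0, since 1 is then projected to the zero
    space. *)
Definition unit_at (i : I) (a : P) : D a :=
  dsum_single i (fun j => vsproj (itv_space F (J j) a) (1 : F^o)).

Lemma unit_at_neq0 i a : J i a -> dsum_val (unit_at i a) i <> 0.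
Proof.
move=> Jia; rewrite dsum_single_id => /(congr1 vsval).
rewrite vsprojK; last by rewrite /itv_space asboolT // memvf.
by move=> /eqP; rewrite oner_eq0.
Qed.

Lemma dsum_mapE a b (h : (a <= b)%O) (v : D a) i :
  dsum_val (pm_map D h v : D b) i = @itv_map F d P (J i) a b (dsum_val v i).
Proof. by []. Qed.

Lemma unit_at_map i a b (h : (a <= b)%O) : J i a -> J i b ->
  dsum_val (pm_map D h (unit_at i a) : D b) i <> 0.
Proof.
move=> Jia Jib; rewrite dsum_mapE.
move=> /(congr1 (@itv_map F d P (J i) b a)).
rewrite itv_mapK // linear0; exact: unit_at_neq0.
Qed.

(** An earlier point [t y] cannot lie in [J i], so nothing coming from it has a coordinate there. *)
Lemma aged_coord x p (v : D p) i : aged x v -> least i x -> dsum_val v i = 0.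
Proof.
move=> [->|[y [h [w [yx ->]]]]] [_ lb]; first by [].
rewrite dsum_mapE (itv_space_out (dsum_val w i)) ?linear0 //. move=> /lb.
by rewrite (lt_geF yx).
Qed.

(** By generation the unit at any [p] in [J i] comes from some [t y] below [p], and its nonzero
    coordinate [i] forces [t y] into [J i]. The first such point of the chain is then below all of
    [J i]. *)
Lemma least_exists i : exists x, least i x.
Proof.
have below p : J i p -> exists2 y, J i (t y) & (t y <= p)%O.
  move=> Jp; have [E|y [h [w E]]] := D_gen (v := unit_at i p).
    by case: (unit_at_neq0 Jp); rewrite E.
  exists y => //; apply: contrapT => nJ; apply: (unit_at_neq0 Jp).
  by rewrite E dsum_mapE (itv_space_out (dsum_val w i)) ?linear0.
have [[p Jp] _ _] := hJ i; have [y0 Jy0 _] := below p Jp.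
have [|y /asboolP Jy ymin] :=
    chain_min t_chain (Q := fun y => `[< J i (t y) >]) (x0 := y0).
  exact/asboolP.
exists y; split=> // q /below[z Jz zq]; apply: le_trans zq.
by apply: ymin; apply/asboolP.
Qed.

Lemma least_uniq i x y : least i x -> least i y -> x = y.
Proof.
move=> [Jx lx] [Jy ly]; apply: t_inj; apply/le_anti.
by rewrite lx // ly.
Qed.

(** Two intervals born at [t x] would give two units, none of whose nontrivial combinations is aged,
    against [D_one]. *)
Lemma least_inj i j x : least i x -> least j x -> i = j.
Proof.
move=> li lj; apply: contrapT => ij.
have [k [l [kl old]]] := D_one (unit_at i (t x)) (unit_at j (t x)).
have := aged_coord old li; have := aged_coord old lj.
have -> : dsum_val (k *: unit_at i (t x) + l *: unit_at j (t x)) i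
  = k *: dsum_val (unit_at i (t x)) i + l *: dsum_val (unit_at j (t x)) i by [].
have -> : dsum_val (k *: unit_at i (t x) + l *: unit_at j (t x)) j
  = k *: dsum_val (unit_at i (t x)) j + l *: dsum_val (unit_at j (t x)) j by [].
rewrite [dsum_val (unit_at j (t x)) i]dsum_single_neq //.
rewrite [dsum_val (unit_at i (t x)) j]dsum_single_neq; last by move=> /esym.
rewrite !scaler0 addr0 add0r => /eqP; rewrite scaler_eq0.
move=> /orP[/eqP l0|]; last first.
  by move=> /eqP/(unit_at_neq0 lj.1).
move=> /eqP; rewrite scaler_eq0 => /orP[/eqP k0|].
  by move: kl; rewrite k0 l0 eqxx.
by move=> /eqP/(unit_at_neq0 li.1).
Qed.

Lemma live_least i x : least i x -> (J i `<=` live D x)%classic.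
Proof.
move=> li p Jp; exists (li.2 p Jp), (unit_at i (t x)) => /aged_coord/(_ li).
exact: unit_at_map li.1 Jp.
Qed.

(* The coordinates of an image of [v] live in intervals born at points of the
   chain; if none is born at [t x], the image already comes from the largest of
   these birth points, all of the intervals concerned being alive there. *)
Lemma least_live p x : live D x p -> exists2 i, least i x & J i p.
Proof.
move=> [h [v nold]]; apply: contrapT => none; apply: nold.
set u : D p := pm_map D h v.
have uJ i : dsum_val u i <> 0 -> J i (t x) /\ J i p.
  move=> ui; split; apply: contrapT => nJ; apply: ui.
    by rewrite dsum_mapE (itv_space_out (dsum_val v i)) ?linear0.
  exact: itv_space_out.
clearbody u.
pose Q y := `[< exists2 i, dsum_val u i <> 0 & least i y >].
have Qx y : Q y -> (t y < t x)%O.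
  move=> /asboolP[i ui li]; rewrite lt_neqAle li.2 ?andbT; last by case: (uJ i ui).
  apply/eqP => /t_inj yx; apply: none; exists i; first by rewrite -yx.
  by case: (uJ i ui).
case: (pselect (exists y, Q y)) => [[y0 Qy0]|nQ]; last first.
  left; apply: dsum_eq => i; apply: contrapT => ui.
  by have [y ly] := least_exists i; apply: nQ; exists y; apply/asboolP; exists i.
have [y Qy ymax] := chain_max t_chain Qy0.
have yp : (t y <= p)%O by apply: le_trans (ltW (Qx y Qy)) h.
(* The preimage at [t y] is [u] carried backwards, coordinate by coordinate. *)
right; exists y, yp, (dsum_map (fun i => @itv_map F d P (J i) p (t y)) u).
split; first exact: Qx.
apply: dsum_eq => i; rewrite dsum_mapE [X in itv_map _ X]/=.
case: (pselect (dsum_val u i = 0)) => [->|ui]; first by rewrite !linear0.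
rewrite itv_mapK //; have [z lz] := least_exists i.
(* The point [t y] lies between the birth [t z] of [J i] and [p], so convexity puts it in [J i]. *)
have [_ cJ _] := hJ i; apply: (cJ (t z) p) => //; first by case: lz.
  by case: (uJ i ui).
by apply: ymax; apply/asboolP; exists i.
Qed.

Lemma least_liveE i x : least i x -> J i = live D x.
Proof.
move=> li; apply/seteqP; split; first exact: live_least.
by move=> p /least_live[j lj]; rewrite (least_inj li lj).
Qed.

End Barcode.

(** The bijection sends each interval to its birth point. It reaches every [x], because liveness at
    [t x] itself produces an interval born there. *)
Theorem live_barcode (N : pmod F P) (B : multiset P) :
  generated_by N -> one_birth N -> (forall x, live N x (t x)) ->
  is_barcode N B -> multiset_eq B (Multiset (live N)).
Proof.
move=> gen one born [hB iso].
have D_gen := generated_iso iso gen.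
have D_one := one_birth_iso iso one.
have [phi phiP] := choice (least_exists D_gen).
have psi x : {i | least B i x}.
  apply: cid; have := born x; rewrite (live_iso x iso).
  by move=> /(least_live D_gen)[i]; exists i.
exists phi => [|i]; last by rewrite /= (live_iso _ iso); exact: least_liveE.
exists (fun x => sval (psi x)) => [i|x].
  exact: (least_inj D_one (svalP (psi (phi i))) (phiP i)).
exact: least_uniq (phiP _) (svalP (psi x)).
Qed.

End Live.

(** * Reindexing direct sums *)

Lemma inj_surj_bijective (A B : Type) (f : A -> B) :
  injective f -> (forall b, exists a, f a = b) -> bijective f.
Proof.
move=> finj /choice[g fg]; exists g => // a; apply: finj; exact: fg.
Qed.

Section Reindex.
Variables (F : fieldType) (I J : Type) (V : I -> lmodType F).
Variables (phi : I -> J) (psi : J -> I).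
Hypotheses (phiK : cancel phi psi) (psiK : cancel psi phi).

Fact dsum_reindex_subproof (v : dsum V) :
  ((fun j => dsum_val v (psi j)) : dprod (V \o psi))
    \in @fin_supp F J (V \o psi).
Proof.
case: v => v /= /asboolP fv; apply/asboolP.
apply: (@sub_finite_set _ _ (phi @` dsupp v)%classic); last exact: finite_image.
by move=> j vj; exists (psi j).
Qed.

Definition dsum_reindex (v : dsum V) : dsum (V \o psi) :=
  Dsum (dsum_reindex_subproof v).

Fact dsum_reindex_linear : linear dsum_reindex.
Proof. by move=> k u v; apply: dsum_eq. Qed.
HB.instance Definition _ :=
  GRing.isSemilinear.Build F (dsum V) (dsum (V \o psi)) _ dsum_reindex
    (GRing.semilinear_linear dsum_reindex_linear).

Lemma dsum_reindex_bij : bijective dsum_reindex.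
Proof.
apply: inj_surj_bijective => [u v /(congr1 (@dsum_val _ _ _)) uv|[h hfin]].
  apply: dsum_eq => i; rewrite -(phiK i).
  exact: (congr1 (fun g : dprod (V \o psi) => g (phi i)) uv).
pose g : dprod V := fun i => ecast i (V i) (phiK i) (h (phi i)).
have gE j : g (psi j) = h j.
  (* Generalizing the proof lets [psiK] turn the cast into one along a loop, which proof irrelevance
     removes. *)
  rewrite /g; move: (phiK (psi j)); rewrite psiK => e.
  by rewrite (Prop_irrelevance e erefl).
have gfin : g \in @fin_supp F I V.
  move: hfin => /asboolP hfin; apply/asboolP.
  apply: (@sub_finite_set _ _ (psi @` dsupp h)%classic); last exact: finite_image.
  move=> i gi; exists (phi i); last exact: phiK.
  by rewrite /dsupp /= -gE phiK.
by exists (Dsum gfin); apply: dsum_eq => j; rewrite /= gE.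
Qed.

End Reindex.

Lemma is_barcode_eq (F : fieldType) d (P : porderType d) (N : pmod F P)
    (A B : multiset P) :
  multiset_eq A B -> is_barcode N A -> is_barcode N B.
Proof.
case: A B => [I A] [J B] [/= phi [psi phiK psiK] AB] [/= hA [f [bij nat]]].
(* Once [B] is replaced by [A \o psi], both sums have the same summands and need no transport. *)
have EB : B = A \o psi by apply: funext => j /=; rewrite AB psiK.
subst B; exists (fun j => hA (psi j)).
exists (fun a =>
  dsum_reindex (V := fun i => interval_module F (hA i) a) psiK \o f a).
split=> [a|a b h v].
  apply: (bij_comp _ (bij a)); exact: (dsum_reindex_bij _ phiK psiK).
by rewrite /= nat; exact: dsum_eq.
Qed.

(** * Degree-zero chains and boundaries *)

Section ZerothHomology.
Variables (F : fieldType) (X : finType).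
Implicit Types (K : complex X) (c : ambient F X).

Lemma chainsP n K c :
  c \in chains F n K <-> forall A, c A <> 0 -> A \in simplices K /\ #|A| = n.+1.
Proof.
split=> [/memv_sumP[u uP ->] A|supp].
  rewrite sum_ffunE => sA; apply: contrapT => nA; apply: sA.
  apply: big1 => B /andP[KB /eqP nB].
  have /vlineP[k ->] := uP B (introT andP (conj KB (introT eqP nB))).
  rewrite !ffunE; case: eqP => [AB|]; last by rewrite scaler0.
  by case: nA; rewrite AB.
have -> : c = \sum_A c A *: simplex F A.
  apply/ffunP => B; rewrite sum_ffunE (bigD1 B) //= big1 => [|A AB].
    by rewrite !ffunE eqxx addr0 /GRing.scale /= mulr1.
  by rewrite !ffunE eq_sym (negPf AB) scaler0.
apply: memv_suml => A _; have [->|/eqP cA] := eqVneq (c A) 0.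
  by rewrite scale0r mem0v.
have [KA nA] := supp A cA; apply/memvZ.
by apply: (subvP (sumv_sup A _ (subvv _))); rewrite ?memv_line // KA nA eqxx.
Qed.

Lemma cycles0 K : cycles F 0 K = chains F 0 K.
Proof.
apply/vspaceP => c; rewrite memv_cap andb_idr // => /chainsP supp.
rewrite memv_ker lfunE /= /bd_fun big1 // => A A1; apply: big1 => a _.
have [->|/eqP cA] := eqVneq (c A) 0; first by rewrite mulr0 scale0r.
by have [_ nA] := supp A cA; rewrite nA in A1.
Qed.

Lemma enum_edge (A : {set X}) : #|A| = 2 ->
  exists u v, [/\ u != v, enum A = [:: u; v] & A = [set u; v]%SET].
Proof.
rewrite cardE; case E: (enum A) => [|u [|v []]] // _; exists u, v; split=> //.
  by have := enum_uniq A; rewrite E /= inE andbT.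
by apply/setP => z; rewrite -mem_enum E !inE.
Qed.

Lemma bd_edge (A : {set X}) u v : enum A = [:: u; v] ->
  bd F X (simplex F A) = simplex F [set v]%SET - simplex F [set u]%SET.
Proof.
move=> E; have uv : u != v by have := enum_uniq A; rewrite E /= inE andbT.
have AE : A = [set u; v]%SET by apply/setP => z; rewrite -mem_enum E !inE.
rewrite lfunE /= /bd_fun (bigD1 A) /=; last by rewrite cardE E.
rewrite [X in _ + X]big1 => [|B /andP[_ BA]]; last first.
  by apply: big1 => a _; rewrite ffunE (negPf BA) mulr0 scale0r.
rewrite addr0 -big_enum /= E big_cons big_seq1 /= eqxx (negPf uv) eqxx.
rewrite ffunE eqxx expr0 expr1 !mulr1 scale1r scaleN1r.
congr (simplex F _ - simplex F _); apply/setP => z; rewrite AE !inE.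
  by have [->|_] := eqVneq z u; rewrite /= ?(negPf uv).
by have [->|_] := eqVneq z v; rewrite /= ?orbF // eq_sym (negPf uv).
Qed.

(** The enumeration order of the two vertices affects only a sign, which the subspace absorbs. *)
Lemma boundaries0_edge K a b : [set a; b]%SET \in simplices K ->
  simplex F [set a]%SET - simplex F [set b]%SET \in boundaries F 0 K.
Proof.
have [->|ab] := eqVneq a b; first by rewrite subrr mem0v.
set A := [set a; b]%SET => KA; have A2 : #|A| = 2 by rewrite cards2 ab.
have bdA : bd F X (simplex F A) \in boundaries F 0 K.
  apply: memv_img; apply/chainsP => B; rewrite ffunE.
  by case: eqP => [->|].
have [u [v [uv E AE]]] := enum_edge A2; move: bdA; rewrite (bd_edge E).
have : a \in A by rewrite !inE eqxx.
have : b \in A by rewrite !inE eqxx orbT.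
rewrite AE !inE => /orP[]/eqP-> /orP[]/eqP-> //; rewrite ?subrr ?mem0v //.
by rewrite -memvN opprB.
Qed.

(** The pairing of a 0-cochain with a chain. *)
Definition cochain_eval (phi : X -> F) (c : ambient F X) : F :=
  \sum_x phi x * c [set x]%SET.

Lemma cochain_evalB phi c e :
  cochain_eval phi (c - e) = cochain_eval phi c - cochain_eval phi e.
Proof.
by rewrite /cochain_eval -sumrB; apply: eq_bigr => x _; rewrite !ffunE mulrBr.
Qed.

Lemma cochain_eval_simplex phi a :
  cochain_eval phi (simplex F [set a]%SET) = phi a.
Proof.
rewrite /cochain_eval (bigD1 a) //= big1 => [|x xa].
  by rewrite ffunE eqxx mulr1 addr0.
by rewrite ffunE (inj_eq set1_inj) (negPf xa) mulr0.
Qed.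

(** A function constant along edges is a cocycle; this serves to show that a chain is not a
    boundary. *)
Lemma cochain_eval_boundary K phi c :
  (forall a b, [set a; b]%SET \in simplices K -> phi a = phi b) ->
  c \in boundaries F 0 K -> cochain_eval phi c = 0.
Proof.
move=> cst /memv_imgP[g /memv_sumP[u uP ->] ->].
rewrite linear_sum /cochain_eval.
under eq_bigr do rewrite sum_ffunE mulr_sumr.
rewrite exchange_big; apply: big1 => A /= /andP[KA /eqP A2].
have /vlineP[k ->] := uP A (introT andP (conj KA (introT eqP A2))).
have [s [t [st E AE]]] := enum_edge A2.
rewrite linearZ /= (bd_edge E).
transitivity (k * cochain_eval phi (simplex F [set t]%SET - simplex F [set s]%SET)).
  by rewrite /cochain_eval mulr_sumr; apply: eq_bigr => x _; rewrite ffunE mulrCA.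
rewrite cochain_evalB !cochain_eval_simplex (cst s t) ?subrr ?mulr0 //.
by rewrite -AE.
Qed.

End ZerothHomology.

(** * Births and liveness in the Rips bifiltration *)

Section RipsStaircode.
Import Order.ProdSyntax.
Variables (R : realType) (F : fieldType) (X : finMetricType R) (f : X -> R).
Hypothesis f_inj : injective f.

Definition birth (x : X) : R *p R := (f x, 0).

Lemma birth_leE x (p : R *p R) : (birth x <= p)%O = (f x <= p.1) && (0 <= p.2).
Proof. by rewrite leEprod. Qed.

Lemma birth_le x y : (birth x <= birth y)%O = (f x <= f y).
Proof. by rewrite birth_leE lexx andbT. Qed.

Lemma birth_lt x y : (birth x < birth y)%O = (f x < f y).
Proof. by rewrite lt_leAnge !birth_le -lt_leAnge. Qed.

Lemma birth_chain x y : (birth x >=< birth y)%O.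
Proof. by rewrite /Order.comparable !birth_le le_total. Qed.

Lemma birth_inj : injective birth.
Proof. by move=> x y [/f_inj]. Qed.

Local Notation K := (rips_bifiltration f).
Local Notation M := (rips_H0 f F).

Lemma rips_vertex p x : ([set x]%SET \in simplices (K p)) = (birth x <= p)%O.
Proof.
rewrite birth_leE !inE finset.sub1set inE -card_gt0 cards1 /=; congr (_ && _).
apply/forall_inP/idP => [/(_ x (set11 x))/forall_inP/(_ x (set11 x))|p2 y].
  by rewrite mdistxx.
by move=> /set1P->; apply/forall_inP => z /set1P->; rewrite mdistxx.
Qed.

Lemma rips_edge p a b : 0 <= p.2 -> rips_step f p.1 p.2 a b ->
  [set a; b]%SET \in simplices (K p).
Proof.
move=> p2 /and3P[]; rewrite !inE => fa fb ab.
rewrite -card_gt0 cards2 /=; apply/andP; split.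
  by apply/fintype.subsetP => z; rewrite !inE => /orP[]/eqP->.
apply/forall_inP => y; rewrite !inE => Y; apply/forall_inP => z; rewrite !inE => Z.
by move: Y Z => /orP[]/eqP-> /orP[]/eqP->; rewrite ?mdistxx // metric_sym.
Qed.

Lemma rips_edge_step p a b : [set a; b]%SET \in simplices (K p) ->
  rips_step f p.1 p.2 a b.
Proof.
rewrite !inE => /and3P[_ /fintype.subsetP sub /forall_inP dist].
have A : a \in [set a; b]%SET by rewrite !inE eqxx.
have B : b \in [set a; b]%SET by rewrite !inE eqxx orbT.
apply/and3P; split; [exact: sub|exact: sub|].
by have /forall_inP/(_ b B) := dist a A.
Qed.

Lemma rips_chains0P p c : c \in chains F 0 (K p) <->
  forall A, c A <> 0 -> exists2 x, A = [set x]%SET & (birth x <= p)%O.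
Proof.
split=> [/chainsP supp A /supp[KA /eqP/cards1P[x AE]]|supp].
  by exists x => //; rewrite -rips_vertex -AE.
by apply/chainsP => A /supp[x -> xp]; rewrite cards1 rips_vertex.
Qed.

Lemma rips_H0_mapE p q (h : (p <= q)%O) c : c \in chains F 0 (K p) ->
  pm_map M h (hclass 0 (K p) c) = hclass 0 (K q) c.
Proof.
by move=> Kc; apply: homology_mapE; rewrite ?cycles0 ?rips_bifiltration_mono.
Qed.

Lemma rips_H0_hclass p (v : M p) :
  exists2 c, c \in chains F 0 (K p) & v = hclass 0 (K p) c.
Proof.
exists (vsval (repr v)); first by rewrite -cycles0; exact: subvsP.
by rewrite [RHS]hclass_repr.
Qed.

Lemma rips_chains0S p q c : (p <= q)%O ->
  c \in chains F 0 (K p) -> c \in chains F 0 (K q).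
Proof. by move=> /(rips_bifiltration_mono f) pq; apply/subvP/chainsS. Qed.

(** Birth points form a chain, so all vertices of [c] are present once its youngest one is. *)
Lemma rips_chains0_youngest p c : c \in chains F 0 (K p) -> c <> 0 ->
  exists y, [/\ c [set y]%SET <> 0, (birth y <= p)%O &
                c \in chains F 0 (K (birth y))].
Proof.
move=> /rips_chains0P supp c0.
have [A cA] : exists A, c A <> 0.
  apply: contrapT => nA; apply: c0; apply/ffunP => A; rewrite ffunE.
  by apply: contrapT => cA; apply: nA; exists A.
have [x AE xp] := supp A cA.
have [|y /eqP cy ymax] :=
    chain_max birth_chain (Q := fun y => c [set y]%SET != 0) (x0 := x).
  by rewrite -AE; apply/eqP.
exists y; split=> //; first by have [z /set1_inj->] := supp _ cy.
apply/rips_chains0P => B cB; have [z BE _] := supp B cB.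
by exists z => //; apply: ymax; rewrite -BE; apply/eqP.
Qed.

(** Translates ageing to chains. Conversely, a nonzero [e] lives at the birth of its youngest
    vertex, which is the earlier point sought. *)
Lemma rips_agedP x p c : c \in chains F 0 (K p) ->
  aged birth (N := M) x (p := p) (hclass 0 (K p) c) <->
  exists e, [/\ e \in chains F 0 (K p),
                forall z, e [set z]%SET <> 0 -> f z < f x &
                c - e \in boundaries F 0 (K p)].
Proof.
move=> Kc; split=> [[c0|[y [h [w [yx]]]]]|[e [Ke ex ce]]].
- exists 0; split; [exact: mem0v|by move=> z; rewrite ffunE|].
  by apply/hclass_eq; rewrite ?cycles0 ?mem0v // c0 /hclass !linear0.
- have [e Ke ->] := rips_H0_hclass w; rewrite rips_H0_mapE // => ce.
  exists e; split; first exact: rips_chains0S Ke.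
    move=> z ez; rewrite -birth_lt; apply: le_lt_trans yx.
    by move: Ke => /rips_chains0P/(_ _ ez)[z' /set1_inj->].
  by apply/hclass_eq; rewrite ?cycles0 // (rips_chains0S h).
have -> : hclass 0 (K p) c = hclass 0 (K p) e by apply/hclass_eq; rewrite ?cycles0.
have [->|/eqP e0] := eqVneq e 0; first by left; rewrite /hclass !linear0.
have [y [ey yp Kye]] := rips_chains0_youngest Ke e0.
right; exists y, yp, (hclass 0 (K (birth y)) e); rewrite rips_H0_mapE //.
by rewrite birth_lt; split=> //; exact: ex.
Qed.

Lemma rips_H0_generated : generated_by birth M.
Proof.
move=> p v; have [c Kc ->] := rips_H0_hclass v => c0.
have [|y [_ yp Kyc]] := rips_chains0_youngest Kc.
  by move=> cE; apply: c0; rewrite cE /hclass !linear0.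
by exists y, yp, (hclass 0 (K (birth y)) c); rewrite rips_H0_mapE.
Qed.

(** As [f] is injective, every vertex present at [birth x] other than [x] is strictly older. So a
    combination is aged as soon as its coefficient at [x] cancels. *)
Lemma rips_H0_one_birth : one_birth birth M.
Proof.
move=> x u v; have [c Kc ->] := rips_H0_hclass u.
have [e Ke ->] := rips_H0_hclass v.
have [k [l [kl kle]]] : exists k l : F, (k != 0) || (l != 0) /\
    k * c [set x]%SET + l * e [set x]%SET = 0.
  have [cx|cx] := eqVneq (c [set x]%SET) 0.
    by exists 1, 0; rewrite oner_eq0 cx mulr0 mul0r addr0.
  exists (e [set x]%SET), (- c [set x]%SET); rewrite oppr_eq0 cx orbT; split=> //.
  by rewrite mulrC mulNr subrr.
exists k, l; split=> //.
have -> : k *: hclass 0 (K (birth x)) c + l *: hclass 0 (K (birth x)) e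
    = hclass 0 (K (birth x)) (k *: c + l *: e) by rewrite /hclass !linearD !linearZ.
have Kg : k *: c + l *: e \in chains F 0 (K (birth x)) by rewrite memvD ?memvZ.
apply/(rips_agedP x Kg); exists (k *: c + l *: e); rewrite subrr mem0v.
split=> // z gz; move: Kg => /rips_chains0P/(_ _ gz)[z' /set1_inj <-].
rewrite birth_le lt_neqAle => ->; rewrite andbT; apply/eqP => /f_inj zx.
by apply: gz; rewrite zx !ffunE.
Qed.

(** The edge differences telescope along a path. *)
Lemma boundaries_connect p x y : 0 <= p.2 ->
  connect (rips_step f p.1 p.2) x y ->
  simplex F [set x]%SET - simplex F [set y]%SET \in boundaries F 0 (K p).
Proof.
move=> p2 /connectP[s path_s ->]; elim: s x path_s => /= [|z s IH] x.
  by rewrite subrr mem0v.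
move=> /andP[xz /IH]; set w := simplex F [set last z s]%SET => zw.
rewrite -(subrKA (simplex F [set z]%SET)) memvD //.
exact/boundaries0_edge/rips_edge.
Qed.

Lemma block_edge p x a b : [set a; b]%SET \in simplices (K p) ->
  (a \in block f p.1 p.2 x) = (b \in block f p.1 p.2 x).
Proof.
move=> /rips_edge_step ab.
have ba : rips_step f p.1 p.2 b a.
  by case/and3P: ab => A B; rewrite metric_sym => ?; apply/and3P.
case/and3P: (ab); rewrite !inE => -> -> _ /=.
apply/idP/idP => xa; apply: connect_trans xa _; exact: connect1.
Qed.

Lemma rips_live x : live birth M x = staircase f x.
Proof.
apply/seteqP; split=> p.
  move=> [h [v]]; have [c Kc ->] := rips_H0_hclass v; rewrite rips_H0_mapE //.
  have Kpc := rips_chains0S h Kc; move=> nold.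
  have /andP[xp p2] : (f x <= p.1) && (0 <= p.2) by rewrite -birth_leE.
  split=> // [|y yx nyx]; first by rewrite inE.
  have [//|fyx|/f_inj xy] := ltgtP (f x) (f y); last by rewrite xy eqxx in nyx.
  have yp : (birth y <= p)%O by rewrite birth_leE p2 (le_trans (ltW fyx)).
  case: nold; apply/(rips_agedP x Kpc).
  have Kx z : (birth z <= p)%O -> simplex F [set z]%SET \in chains F 0 (K p).
    move=> zp; apply/rips_chains0P => A; rewrite ffunE.
    by case: eqP => // ->; exists z.
  (* The vertex [x] is traded for the older [y] of its block, which changes [c] by a boundary. *)
  exists (c - c [set x]%SET *: (simplex F [set x]%SET - simplex F [set y]%SET)).
  split.
  - by rewrite memvB ?memvZ ?memvB ?Kx.
  - move=> z; rewrite !ffunE !(inj_eq set1_inj).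
    have [->|zy] := eqVneq z y; first by [].
    have [->|zx] := eqVneq z x; first by rewrite subr0 /GRing.scale /= mulr1 subrr.
    rewrite subrr scaler0 subr0 => cz.
    move: Kc => /rips_chains0P/(_ _ cz)[z' /set1_inj <-].
    by rewrite birth_le lt_neqAle => ->; rewrite (inj_eq f_inj) zx.
  rewrite opprB addrC subrK memvZ // boundaries_connect //.
  by move: yx; rewrite inE => /andP[].
move=> [p2 xp oldest].
have h : (birth x <= p)%O by rewrite birth_leE p2 andbT; rewrite inE in xp.
have Kx q : (birth x <= q)%O -> simplex F [set x]%SET \in chains F 0 (K q).
  move=> xq; apply/rips_chains0P => A; rewrite ffunE.
  by case: eqP => // ->; exists x.
exists h, (hclass 0 (K (birth x)) (simplex F [set x]%SET)).
rewrite rips_H0_mapE ?Kx //; move/(rips_agedP x (Kx p h)) => [e [Ke ex]].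
(* The indicator of the block of [x] is a cocycle. It is 1 on [x] and 0 on [e], whose vertices are
   older than [x] and hence outside the block. *)
pose phi z : F := (z \in block f p.1 p.2 x)%:R.
move=> /(cochain_eval_boundary (phi := phi)).
have xb : x \in block f p.1 p.2 x by rewrite inE xp connect0.
rewrite cochain_evalB cochain_eval_simplex [phi x]/phi xb.
have -> : cochain_eval phi e = 0.
  apply: big1 => z _; have [->|/eqP/ex zx] := eqVneq (e [set z]%SET) 0.
    by rewrite mulr0.
  rewrite /phi; case zb: (z \in block f p.1 p.2 x); last by rewrite mul0r.
  have nzx : z != x by apply: contraTneq zx => ->; rewrite ltxx.
  by have := oldest z zb nzx; rewrite /older (lt_gtF zx).
rewrite subr0 => E; suff /eqP : (1 : F) = 0 by rewrite oner_eq0.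
by apply: E => a b ab; rewrite /phi (block_edge x ab).
Qed.

Lemma staircase_birth x : staircase f x (birth x).
Proof.
split=> [||y]; rewrite ?inE //= => /andP[_ /connectP[s path_s ->]].
have -> : last x s = x; last by rewrite eqxx.
(* At scale 0 each step stays in place. The bound [f x] is generalized apart from [x], as it stays
   fixed while the starting vertex moves. *)
elim: s x {path_s}(f x) path_s => //= z s IH x r /andP[/and3P[_ _ xz] /IH ->].
by apply/esym/eqP; rewrite -[_ == _]negbK -mdist_gt0 -leNgt.
Qed.

End RipsStaircode.

Theorem theorem4p16 (R : realType) (F : fieldType)
    (X : finMetricType R) (f : X -> R) :
  injective f ->
  interval_decomposable (rips_H0 f F) ->
  is_barcode (rips_H0 f F) (staircode f) /\
  forall B, is_barcode (rips_H0 f F) B -> multiset_eq B (staircode f).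
Proof.
move=> f_inj [B0 B0P].
have unique B : is_barcode (rips_H0 f F) B -> multiset_eq B (staircode f).
  move=> BP; have [|phi phi_bij E] := live_barcode (@birth_chain _ _ f)
    (birth_inj f_inj) (@rips_H0_generated _ F _ f)
    (rips_H0_one_birth f_inj (F := F)) _ BP.
    by move=> x; rewrite rips_live //; exact: staircase_birth.
  by exists phi => // i; rewrite E /= rips_live.
(* Existence follows from uniqueness: the given barcode [B0] is a reindexing of the staircode. *)
by split=> //; apply: is_barcode_eq (unique _ B0P) B0P.
Qed.
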